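(* Let $H(k)=\sum_{j=1}^{k-1}\frac{1}{(2j)^2}$ for integers $k\ge 1$. For all even integers $n\geq 0$ we have $$\sum_{k=1}^\infty\frac{4^kH(k)}{\binom{2k}{k}k(2k+n)} =\frac{\binom{n}{n/2}}{2^{n+4}}\left(\frac{\pi^4}{12}+\pi^2\sum_{j=1}^{\frac{n}{2}}\bigg(\frac{4^j}{\binom{2j}{j}}-1\bigg)\frac{1}{j^2} -2\sum_{r=1}^{n/2}\bigg(\sum_{j=r}^{n/2}\frac{1}{j^2}\bigg)\frac{4^r}{\binom{2r}{r}r^2}\right),$$ and for all odd integers $n\geq 1$, $$\sum_{k=1}^\infty\frac{4^kH(k)}{\binom{2k}{k}k(2k+n)} =\frac{2^n}{n\binom{n-1}{\frac{n-1}{2}}}\sum_{r=0}^{\frac{n-1}{2}} \bigg(\frac{\pi^2}{8}-\sum_{j=r}^{\frac{n-1}{2}}\frac{1}{(2j+1)^2}\bigg) \frac{\binom{2r}{r}}{(2r+1)4^r}.$$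
   Context: Empty sums are equal to $0$ (in particular $H(1)=0$). *)

(* Defs.v *)
From Stdlib Require Import Reals.
From Coquelicot Require Import Coquelicot.
Open Scope R_scope.

(* [binom], because Coquelicot's complex numbers shadow Stdlib's binomial [C].
   [Binomial.C n k] is n!/(k!(n-k)!) and is the binomial coefficient
   only for k <= n. *)
Definition binom (n k : nat) : R := Binomial.C n k.

(* The sum of [a j] over p <= j <= q; [sum_n_m] is 0 when q < p. *)
Definition rsum (p q : nat) (a : nat -> R) : R := sum_n_m a p q.

Definition H (k : nat) : R :=
  rsum 1 (k - 1) (fun j => 1 / (2 * INR j) ^ 2).

Definition term (n k : nat) : R :=
  (4 ^ k * H k) / (binom (2 * k) k * INR k * (2 * INR k + INR n)).

(* Main.v *)
Require Import Defs.
From Stdlib Require Import Reals Lra Lia.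
From Coquelicot Require Import Coquelicot.
From Corelib Require Import ssreflect.
Unset SsrRewrite.
Set Bullet Behavior "Strict Subproofs".
Open Scope R_scope.

(* Write w_k = binom(2k,k)/4^k, b_k = 1/(w_k k), a_k = H(k) b_k, and let U(t) and
   S(t) be the sums over k >= 1 of b_k/(2k+t) and a_k/(2k+t); the series in question
   is S(n). Since (2k+1) b_(k+1) = 2k b_k and
   (2k+1) a_(k+1) = 2k a_k + b_k/(2k), telescoping gives
     t U(t) = (t-1) U(t-2) + 2/t,
     t S(t) = (t-1) S(t-2) + (U(0) - U(t))/t.
   At t = 1 the factor t-1 kills the first terms, which settles the odd case by
   induction; the even case starts from U(0) = pi^2/4 and S(0) = pi^4/192.
   These two come from the normalized moments M_p(m), the integral of
   x^p cos(x)^(2m) over [0,pi/2] divided by w_m: integrating by parts twice,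
     M_1(m-1) - M_1(m) = 1/(w_m (2m)^2),  M_3(m-1) - M_3(m) = 6 M_1(m)/(2m)^2,
   and M_1, M_3 tend to 0, so that M_1(0) = pi^2/8 = U(0)/2 and, exchanging the
   order of summation, M_3(0) = pi^4/64 = 3 S(0). *)

(** * Normalized central binomial coefficients *)

Definition wallis (m : nat) : R := binom (2 * m) m / 4 ^ m.

Lemma binom_pos (n k : nat) : 0 < binom n k.
Proof.
  unfold binom, Binomial.C.
  apply Rdiv_lt_0_compat; [|apply Rmult_lt_0_compat]; apply INR_fact_lt_0.
Qed.

Lemma wallis_pos (m : nat) : 0 < wallis m.
Proof.
  apply Rdiv_lt_0_compat; [apply binom_pos | apply pow_lt; lra].
Qed.

Lemma wallis_0 : wallis 0 = 1.
Proof. unfold wallis, binom, Binomial.C; simpl; field. Qed.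

Lemma wallis_S (m : nat) :
  wallis (S m) = (2 * INR m + 1) / (2 * INR m + 2) * wallis m.
Proof.
  unfold wallis, binom, Binomial.C.
  replace (2 * S m - S m)%nat with (S m) by lia.
  replace (2 * m - m)%nat with m by lia.
  replace (2 * S m)%nat with (S (S (2 * m))) by lia.
  rewrite !fact_simpl, !mult_INR, !S_INR, mult_INR.
  simpl (INR 2); simpl (4 ^ S m).
  pose proof (pos_INR m).
  assert (4 ^ m <> 0) by (apply pow_nonzero; lra).
  pose proof (INR_fact_neq_0 m).
  field; repeat split; lra.
Qed.

(** * Moments against powers of the cosine *)

Definition moment (g : R -> R) (n : nat) : R :=
  RInt (fun x => g x * cos x ^ n) 0 (PI / 2).

Lemma continuous_cos_pow (n : nat) (x : R) : continuous (fun y => cos y ^ n) x.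
Proof.
  apply: ex_derive_continuous. auto_derive. exact I.
Qed.

Lemma is_RInt_moment (g : R -> R) (n : nat) :
  (forall x, continuous g x) ->
  is_RInt (fun x => g x * cos x ^ n) 0 (PI / 2) (moment g n).
Proof.
  intros Hg. apply (RInt_correct (V := R_CompleteNormedModule)).
  apply ex_RInt_continuous; intros x _.
  apply (continuous_mult g); [apply Hg | apply continuous_cos_pow].
Qed.

Lemma moment_ext (g h : R -> R) (n : nat) :
  (forall x, g x = h x) -> moment g n = moment h n.
Proof.
  intros E. apply RInt_ext; intros x _. now rewrite E.
Qed.

Lemma moment_scal (g : R -> R) (c : R) (n : nat) :
  (forall x, continuous g x) -> moment (fun x => c * g x) n = c * moment g n.
Proof.
  intros Hg. apply is_RInt_unique.
  apply is_RInt_ext with (fun x => scal c (g x * cos x ^ n)).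
  - intros x _. unfold scal; simpl; unfold mult; simpl. ring.
  - apply: is_RInt_scal. now apply is_RInt_moment.
Qed.

Lemma moment_plus (g h : R -> R) (n : nat) :
  (forall x, continuous g x) -> (forall x, continuous h x) ->
  moment (fun x => g x + h x) n = moment g n + moment h n.
Proof.
  intros Hg Hh. apply is_RInt_unique.
  apply is_RInt_ext with (fun x => plus (g x * cos x ^ n) (h x * cos x ^ n)).
  - intros x _. unfold plus; simpl. ring.
  - apply: is_RInt_plus; now apply is_RInt_moment.
Qed.

Lemma cos_nonneg (x : R) : 0 < x < PI / 2 -> 0 <= cos x.
Proof.
  intros Hx. apply Rlt_le, cos_gt_0; lra.
Qed.

Lemma moment_le (g h : R -> R) (n : nat) :
  (forall x, continuous g x) -> (forall x, continuous h x) ->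
  (forall x, 0 < x < PI / 2 -> g x <= h x) -> moment g n <= moment h n.
Proof.
  intros Hg Hh E. pose proof PI_RGT_0.
  apply (is_RInt_le (fun x => g x * cos x ^ n) (fun x => h x * cos x ^ n) 0 (PI / 2));
    [lra | now apply is_RInt_moment | now apply is_RInt_moment |].
  intros x Hx. apply Rmult_le_compat_r; [|now apply E].
  now apply pow_le, cos_nonneg.
Qed.

(* Integrates [(g * (cos^(n+2))' - g' * cos^(n+2))'] over [0, PI/2]. *)
Lemma moment_rec (g g1 g2 : R -> R) (n : nat) :
  (forall x, is_derive g x (g1 x)) -> (forall x, is_derive g1 x (g2 x)) ->
  (forall x, continuous g2 x) ->
  (INR n + 2) * (INR n + 1) * moment g n - (INR n + 2) ^ 2 * moment g (n + 2)
  = moment g2 (n + 2) + g1 0.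
Proof.
  intros Hg Hg1 Cg2.
  assert (Cg : forall x, continuous g x)
    by (intros x; apply: ex_derive_continuous; eexists; apply Hg).
  assert (Cg1 : forall x, continuous g1 x)
    by (intros x; apply: ex_derive_continuous; eexists; apply Hg1).
  set (F := fun x => - (INR n + 2) * (g x * (cos x ^ (n + 1) * sin x))
                     - g1 x * cos x ^ (n + 2)).
  set (F' := fun x => minus (minus (scal ((INR n + 2) * (INR n + 1)) (g x * cos x ^ n))
                       (scal ((INR n + 2) ^ 2) (g x * cos x ^ (n + 2))))
                       (g2 x * cos x ^ (n + 2))).
  assert (HF : is_RInt F' 0 (PI / 2) (minus (F (PI / 2)) (F 0))).
  { apply: is_RInt_derive.
    - intros x _. unfold F, F'. auto_derive.
      + repeat split; (exact (ex_intro _ (g1 x) (Hg x)) || exact (ex_intro _ (g2 x) (Hg1 x))).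
      + replace (Derive (fun x => g x) x) with (g1 x) by (symmetry; apply is_derive_unique, Hg).
        replace (Derive (fun x => g1 x) x) with (g2 x) by (symmetry; apply is_derive_unique, Hg1).
        unfold minus, plus, opp, scal; simpl; unfold mult; simpl.
        rewrite !plus_INR. simpl (INR 2). simpl (INR 1).
        replace (Init.Nat.pred (n + 1)) with n by lia.
        replace (Init.Nat.pred (n + 2)) with (n + 1)%nat by lia.
        rewrite !pow_add. simpl.
        assert (S2 : sin x * sin x = 1 - cos x * cos x)
          by (pose proof (sin2_cos2 x) as E; unfold Rsqr in E; lra).
        (* The two sides agree only modulo sin^2 + cos^2 = 1; adding this vanishing multiple of 1 -
           cos^2 - sin^2 eliminates the sine and leaves a polynomial identity. *)
        match goal with |- ?l = ?r =>
          replace l with (l + (INR n + 2) * (INR n + 1) * g x * cos x ^ n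
             * (1 - cos x * cos x - sin x * sin x)) by (rewrite S2; ring) end.
        ring.
    - intros x _. unfold F'.
      assert (forall h k, (forall x, continuous h x) ->
         continuous (fun x => h x * cos x ^ k) x).
      { intros h k Hh. apply (continuous_mult h); [apply Hh | apply continuous_cos_pow]. }
      apply: continuous_minus; [apply: continuous_minus|]; auto;
        apply: continuous_scal_r; auto. }
  assert (HF2 : is_RInt F' 0 (PI / 2)
    (minus (minus (scal ((INR n + 2) * (INR n + 1)) (moment g n))
                  (scal ((INR n + 2) ^ 2) (moment g (n + 2)))) (moment g2 (n + 2)))).
  { apply: is_RInt_minus; [apply: is_RInt_minus; apply: is_RInt_scal|];
      now apply is_RInt_moment. }
  pose proof (is_RInt_unique _ _ _ _ HF) as E1.
  rewrite (is_RInt_unique _ _ _ _ HF2) in E1.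
  (* At PI/2 the positive powers of cos kill [F]; at 0 the sine kills its first part and [- g1 0]
     remains. *)
  revert E1. unfold F. rewrite cos_PI2, cos_0, sin_0, !pow1, !pow_i by lia.
  unfold minus, plus, opp, scal; simpl; unfold mult; simpl. lra.
Qed.

Lemma continuous_id_pow (p : nat) (x : R) : continuous (fun y => y ^ p) x.
Proof.
  apply: ex_derive_continuous. auto_derive. exact I.
Qed.

(** Wallis' integral. For a constant [g] the recurrence has neither a second-derivative nor a
    boundary term, and its ratio (2m+1)/(2m+2) is that of [wallis]. *)
Lemma moment_const_even (m : nat) : moment (fun x => x ^ 0) (2 * m) = PI / 2 * wallis m.
Proof.
  induction m as [|m IH].
  - rewrite wallis_0. unfold moment.
    rewrite (RInt_ext _ (fun _ => 1)) by (intros; simpl; ring).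
    rewrite RInt_const. unfold scal; simpl; unfold mult; simpl. ring.
  - rewrite wallis_S.
    (* The zero second derivative is written [0 * 0 ^ 0] so that [moment_scal] can pull out the
       factor 0. *)
    assert (E := moment_rec (fun x => x ^ 0) (fun _ => 0) (fun _ => 0 * 0 ^ 0) (2 * m)).
    specialize (E ltac:(intros x; simpl; auto_derive; [exact I | ring])).
    specialize (E ltac:(intros x; auto_derive; [exact I | ring])).
    specialize (E (fun x => continuous_const _ x)).
    rewrite (moment_scal (fun _ => 0 ^ 0)) in E by (intros; apply continuous_const).
    replace (2 * S m)%nat with (2 * m + 2)%nat by lia.
    rewrite IH in E. rewrite mult_INR in E. simpl (INR 2) in E.
    pose proof (pos_INR m).
    apply Rmult_eq_reg_l with ((2 * INR m + 2) ^ 2); [|apply pow_nonzero; lra].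
    transitivity ((2 * INR m + 2) * (2 * INR m + 1) * (PI / 2 * wallis m)); [|field; lra].
    lra.
Qed.

(** * Normalized moments and their recurrences *)

Definition nmoment (g : R -> R) (m : nat) : R := moment g (2 * m) / wallis m.

(** Since (2m+2) w_(m+1) = (2m+1) w_m, division by [wallis] gives both moments of [g] in
    [moment_rec] the same coefficient, so the recurrence becomes a difference that telescopes. *)
Lemma nmoment_rec (g g1 g2 : R -> R) (m : nat) :
  (forall x, is_derive g x (g1 x)) -> (forall x, is_derive g1 x (g2 x)) ->
  (forall x, continuous g2 x) ->
  nmoment g m = nmoment g (S m)
    + (nmoment g2 (S m) + g1 0 / wallis (S m)) / (2 * INR (S m)) ^ 2.
Proof.
  intros Hg Hg1 Cg2. pose proof (moment_rec g g1 g2 (2 * m) Hg Hg1 Cg2) as E.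
  rewrite mult_INR in E; simpl (INR 2) in E.
  unfold nmoment. replace (2 * S m)%nat with (2 * m + 2)%nat by lia.
  rewrite wallis_S, S_INR. pose proof (pos_INR m). pose proof (wallis_pos m).
  apply Rmult_eq_reg_l with ((2 * INR m + 2) * (2 * INR m + 1) * wallis m);
    [|apply Rgt_not_eq, Rmult_lt_0_compat; [nra | lra]].
  transitivity ((2 * INR m + 2) * (2 * INR m + 1) * moment g (2 * m)); [field; lra|].
  replace (moment g2 (2 * m + 2)) with ((2 * INR m + 2) * (2 * INR m + 1) * moment g (2 * m) -
    (2 * INR m + 2) ^ 2 * moment g (2 * m + 2) - g1 0) by lra.
  field; repeat split; lra.
Qed.

(** For g(x) = x the second derivative is zero and only the boundary term g'(0) = 1 survives. *)
Lemma nmoment_id_rec (m : nat) :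
  nmoment (fun x => x ^ 1) m
  = nmoment (fun x => x ^ 1) (S m) + 1 / (wallis (S m) * (2 * INR (S m)) ^ 2).
Proof.
  rewrite (nmoment_rec (fun x => x ^ 1) (fun _ => 1) (fun _ => 0 * 0 ^ 0)).
  - unfold nmoment. rewrite (moment_scal (fun _ => 0 ^ 0)) by (intros; apply continuous_const).
    pose proof (wallis_pos (S m)). assert (0 < INR (S m)) by (apply lt_0_INR; lia).
    field; split; lra.
  - intros x. auto_derive; [exact I | simpl; ring].
  - intros x. auto_derive; [exact I | simpl; ring].
  - intros x. apply continuous_const.
Qed.

(** For g(x) = x^3 the boundary term vanishes and g''(x) = 6x brings in the first moment. *)
Lemma nmoment_cube_rec (m : nat) :
  nmoment (fun x => x ^ 3) m
  = nmoment (fun x => x ^ 3) (S m)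
    + 6 * (nmoment (fun x => x ^ 1) (S m) / (2 * INR (S m)) ^ 2).
Proof.
  rewrite (nmoment_rec (fun x => x ^ 3) (fun x => 3 * x ^ 2) (fun x => 6 * x ^ 1)).
  - unfold nmoment. rewrite (moment_scal (fun x => x ^ 1)) by apply continuous_id_pow.
    pose proof (wallis_pos (S m)). assert (0 < INR (S m)) by (apply lt_0_INR; lia).
    field; split; lra.
  - intros x. auto_derive; [exact I | simpl; ring].
  - intros x. auto_derive; [exact I | simpl; ring].
  - intros x. apply: continuous_scal_r. apply continuous_id_pow.
Qed.

Lemma nmoment_pow_0 (p : nat) :
  nmoment (fun x => x ^ p) 0 = (PI / 2) ^ S p / INR (S p).
Proof.
  unfold nmoment. rewrite wallis_0. unfold Rdiv at 1. rewrite Rinv_1, Rmult_1_r.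
  assert (0 < INR (S p)) by (apply lt_0_INR; lia).
  apply is_RInt_unique.
  (* For m = 0 the cosine power is 1, so this is the plain integral of x^p, put in the form of a
     difference of values of its primitive. *)
  replace ((PI / 2) ^ S p / INR (S p)) with
    (minus ((PI / 2) ^ S p / INR (S p)) (0 ^ S p / INR (S p)))
    by (rewrite (pow_i (S p)) by lia; unfold minus, plus, opp; simpl (AbelianGroup.sort _); unfold Rdiv; simpl; ring).
  apply: (is_RInt_derive (fun x => x ^ S p / INR (S p))).
  - intros x _. auto_derive; [exact I|].
    change (1 * (INR (S p) * x ^ p) * / INR (S p) = x ^ p * 1). field. lra.
  - intros x _. apply (continuous_mult (fun x => x ^ p));
      [apply continuous_id_pow | apply continuous_cos_pow].
Qed.

(** * Decay of the normalized moments *)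

(** The difference sin x - x cos x vanishes at 0 and has derivative x sin x, which is nonnegative
    here. *)
Lemma x_cos_le_sin (x : R) : 0 < x < PI / 2 -> x * cos x <= sin x.
Proof.
  intros Hx. pose proof PI_RGT_0.
  destruct (MVT_cor2 (fun x => sin x - x * cos x) (fun x => x * sin x) 0 x) as [c [E Hc]].
  - lra.
  - intros c _. apply is_derive_Reals. auto_derive; [exact I | ring].
  - rewrite sin_0 in E.
    assert (0 <= sin c) by (apply sin_ge_0; lra).
    assert (0 <= c * sin c * (x - 0)).
    { apply Rmult_le_pos; [apply Rmult_le_pos|]; lra. }
    lra.
Qed.

(** From x^2 cos^2 <= sin^2 = 1 - cos^2, the second moment is at most the difference of two
    consecutive Wallis integrals, (PI/2) w_m/(2m+2). Division by w_(m+1) gives PI/(4m+2), which is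
    below the stated bound. *)
Lemma nmoment_sqr_le (m : nat) :
  nmoment (fun x => x ^ 2) (S m) <= PI / (INR m + 1).
Proof.
  assert (C1 : forall x, continuous (fun x => (x * cos x) ^ 2) x).
  { intros x. apply: ex_derive_continuous. auto_derive. exact I. }
  assert (C2 : forall x, continuous (fun x => sin x ^ 2) x).
  { intros x. apply: ex_derive_continuous. auto_derive. exact I. }
  assert (L : moment (fun x => (x * cos x) ^ 2) (2 * m) <= moment (fun x => sin x ^ 2) (2 * m)).
  { apply moment_le; try assumption. intros x Hx.
    apply pow_incr. split; [|now apply x_cos_le_sin].
    apply Rmult_le_pos; [lra | now apply cos_nonneg]. }
  assert (E1 : moment (fun x => (x * cos x) ^ 2) (2 * m) = moment (fun x => x ^ 2) (2 * S m)).
  { apply RInt_ext; intros x _. replace (2 * S m)%nat with (2 * m + 2)%nat by lia.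
    rewrite pow_add. simpl. ring. }
  assert (E2 : moment (fun x => x ^ 0) (2 * m)
     = moment (fun x => sin x ^ 2) (2 * m) + moment (fun x => x ^ 0) (2 * S m)).
  { transitivity (moment (fun x => sin x ^ 2 + cos x ^ 2) (2 * m)).
    - apply moment_ext; intros x. pose proof (sin2_cos2 x) as E. unfold Rsqr in E. simpl. lra.
    - rewrite moment_plus.
      + f_equal. apply RInt_ext; intros x _. replace (2 * S m)%nat with (2 * m + 2)%nat by lia.
        rewrite pow_add. simpl. ring.
      + assumption.
      + intros; apply continuous_cos_pow. }
  rewrite !moment_const_even in E2. unfold nmoment.
  rewrite wallis_S in E2 |- *. rewrite E1 in L.
  pose proof (wallis_pos m) as W. pose proof (pos_INR m) as P. pose proof PI_RGT_0 as HPI.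
  set (w := wallis m) in *. set (t := INR m) in *.
  assert (0 < (2 * t + 1) / (2 * t + 2) * w).
  { apply Rmult_lt_0_compat; [apply Rdiv_lt_0_compat|]; lra. }
  apply Rle_trans with ((PI / 2 * w / (2 * t + 2)) / ((2 * t + 1) / (2 * t + 2) * w)).
  - apply Rmult_le_compat_r; [apply Rlt_le, Rinv_0_lt_compat; assumption|].
    replace (PI / 2 * w / (2 * t + 2)) with
      (PI / 2 * w - PI / 2 * ((2 * t + 1) / (2 * t + 2) * w)) by (field; lra).
    lra.
  - replace (PI / 2 * w / (2 * t + 2) / ((2 * t + 1) / (2 * t + 2) * w)) with
      (PI * / (4 * t + 2)) by (field; repeat split; lra).
    apply Rmult_le_compat_l; [lra|]. apply Rinv_le_contravar; lra.
Qed.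

Lemma nmoment_le (g h : R -> R) (m : nat) :
  (forall x, continuous g x) -> (forall x, continuous h x) ->
  (forall x, 0 < x < PI / 2 -> g x <= h x) -> nmoment g m <= nmoment h m.
Proof.
  intros. apply Rmult_le_compat_r; [apply Rlt_le, Rinv_0_lt_compat, wallis_pos|].
  now apply moment_le.
Qed.

Lemma nmoment_pow_nonneg (p m : nat) : 0 <= nmoment (fun x => x ^ p) m.
Proof.
  replace 0 with (nmoment (fun _ => 0 * 0 ^ 0) m).
  - apply nmoment_le; [intros; apply continuous_const | apply continuous_id_pow |].
    intros x Hx. rewrite Rmult_0_l. apply pow_le. lra.
  - unfold nmoment. rewrite (moment_scal (fun _ => 0 ^ 0)) by (intros; apply continuous_const).
    unfold Rdiv; ring.
Qed.

Lemma lim_inv_sqrt : is_lim_seq (fun m => / sqrt (INR m + 1)) 0.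
Proof.
  apply (is_lim_seq_inv _ p_infty); [|discriminate].
  apply (filterlim_comp _ _ _ (fun m => INR m + 1) sqrt _ (Rbar_locally p_infty)).
  - apply (is_lim_seq_plus _ _ p_infty 1); [apply is_lim_seq_INR | apply is_lim_seq_const | reflexivity].
  - apply filterlim_sqrt_p.
Qed.

Lemma lim_inv_succ : is_lim_seq (fun m => / (INR m + 1)) 0.
Proof.
  apply (is_lim_seq_inv _ p_infty); [|discriminate].
  apply (is_lim_seq_plus _ _ p_infty 1); [apply is_lim_seq_INR | apply is_lim_seq_const | reflexivity].
Qed.

(** The inequality x <= 1/s + s x^2, from (sx - 1)^2 >= 0, bounds the first moment by the zeroth and
    second ones. The choice s = sqrt(m+1) balances PI/2 against PI/(m+1), for a total of 3
    PI/(2s). *)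
Lemma nmoment_id_lim : is_lim_seq (fun m => nmoment (fun x => x ^ 1) (S m)) 0.
Proof.
  apply is_lim_seq_le_le with (fun _ => 0) (fun m => 3 * PI / 2 * / sqrt (INR m + 1)).
  - intros m. split; [apply nmoment_pow_nonneg|].
    pose proof (pos_INR m).
    set (s := sqrt (INR m + 1)).
    assert (Hs : 0 < s) by (apply sqrt_lt_R0; lra).
    assert (Hss : s * s = INR m + 1) by (apply sqrt_sqrt; lra).
    apply Rle_trans with (nmoment (fun x => / s * x ^ 0 + s * x ^ 2) (S m)).
    + apply nmoment_le; [apply continuous_id_pow | |].
      * intros x. apply: continuous_plus; apply: continuous_scal_r; apply continuous_id_pow.
      * intros x Hx. apply Rmult_le_reg_l with s; [assumption|].
        replace (s * (/ s * x ^ 0 + s * x ^ 2)) with (1 + (s * x) * (s * x))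
          by (simpl; field; lra).
        pose proof (Rle_0_sqr (s * x - 1)) as Q. unfold Rsqr in Q.
        assert (0 < s * x) by (apply Rmult_lt_0_compat; lra).
        simpl. lra.
    + unfold nmoment. rewrite moment_plus, !moment_scal, moment_const_even;
        try apply continuous_id_pow;
        try (intros x; apply: continuous_scal_r; apply continuous_id_pow).
      pose proof (nmoment_sqr_le m) as B. unfold nmoment in B.
      pose proof (wallis_pos (S m)).
      apply Rmult_le_compat_l with (r := s) in B; [|lra].
      rewrite <- Hss in B.
      replace (s * (PI / (s * s))) with (PI * / s) in B by (field; lra).
      replace ((/ s * (PI / 2 * wallis (S m)) + s * moment (fun x : R => x ^ 2) (2 * S m)) / wallis (S m))
        with (PI / 2 * / s + s * (moment (fun x : R => x ^ 2) (2 * S m) / wallis (S m)))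
        by (field; lra).
      lra.
  - apply is_lim_seq_const.
  - replace (Finite 0) with (Rbar_mult (3 * PI / 2) 0) by (simpl; f_equal; ring).
    apply is_lim_seq_scal_l, lim_inv_sqrt.
Qed.

(** On the interval x^3 <= (PI/2) x^2, so the bound on the second moment suffices. *)
Lemma nmoment_cube_lim : is_lim_seq (fun m => nmoment (fun x => x ^ 3) (S m)) 0.
Proof.
  apply is_lim_seq_le_le with (fun _ => 0) (fun m => PI / 2 * PI * / (INR m + 1)).
  - intros m. split; [apply nmoment_pow_nonneg|].
    pose proof PI_RGT_0.
    apply Rle_trans with (nmoment (fun x => PI / 2 * x ^ 2) (S m)).
    + apply nmoment_le; [apply continuous_id_pow | |].
      * intros x. apply: continuous_scal_r; apply continuous_id_pow.
      * intros x Hx. change (x ^ 3) with (x * x ^ 2).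
        apply Rmult_le_compat_r; [apply pow2_ge_0 | lra].
    + unfold nmoment. rewrite moment_scal by apply continuous_id_pow.
      pose proof (nmoment_sqr_le m) as B. unfold nmoment in B.
      unfold Rdiv in *. rewrite !Rmult_assoc. apply Rmult_le_compat_l; [lra|].
      lra.
  - apply is_lim_seq_const.
  - replace (Finite 0) with (Rbar_mult (PI / 2 * PI) 0) by (simpl; f_equal; ring).
    apply is_lim_seq_scal_l, lim_inv_succ.
Qed.

(** * Finite sums and bounds for [H] *)

Lemma rsum_S (p q : nat) (f : nat -> R) :
  (p <= S q)%nat -> rsum p (S q) f = rsum p q f + f (S q).
Proof. intros Hpq. unfold rsum. now rewrite sum_n_Sm. Qed.

Lemma rsum_single (p : nat) (f : nat -> R) : rsum p p f = f p.
Proof. apply sum_n_n. Qed.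

Lemma rsum_empty (p q : nat) (f : nat -> R) : (q < p)%nat -> rsum p q f = 0.
Proof. intros Hpq. now apply: sum_n_m_zero. Qed.

Lemma rsum_ext (p q : nat) (f g : nat -> R) :
  (forall k, (p <= k <= q)%nat -> f k = g k) -> rsum p q f = rsum p q g.
Proof. apply: sum_n_m_ext_loc. Qed.

(** Meant for the double sums of the closed forms: raising the upper limit adds the same term to
    every inner sum, so the weights all shift by one constant [c]. *)
Lemma rsum_shift_weights (p q : nat) (g g' e : nat -> R) (c : R) :
  (p <= S q)%nat -> (forall r, (r <= q)%nat -> g' r = g r + c) ->
  rsum p (S q) (fun r => g' r * e r)
  = rsum p q (fun r => g r * e r) + c * rsum p q e + g' (S q) * e (S q).
Proof.
  intros Hpq Hg. rewrite rsum_S by assumption. f_equal.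
  rewrite (rsum_ext _ _ _ (fun r => plus (g r * e r) (mult c (e r)))).
  - unfold rsum. rewrite sum_n_m_plus.
    apply (f_equal2 Rplus); [reflexivity | apply (sum_n_m_mult_l (K := R_Ring))].
  - intros k Hk. rewrite Hg by lia. unfold plus, mult; simpl. ring.
Qed.

Lemma H_1 : H 1 = 0.
Proof. unfold H. apply rsum_empty. lia. Qed.

Lemma H_S (m : nat) : H (S (S m)) = H (S m) + 1 / (2 * INR (S m)) ^ 2.
Proof.
  unfold H. replace (S (S m) - 1)%nat with (S m) by lia.
  replace (S m - 1)%nat with m by lia. now rewrite rsum_S by lia.
Qed.

(** For k >= 1, 1/(2k)^2 <= 1/(2k) - 1/(2(k+1)), and the right side telescopes. Hence [H] stays
    below 1/2, and [acoef] lies between 0 and [bcoef]. *)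
Lemma H_bounds (m : nat) : 0 <= H (S m) <= 1 / 2 - 1 / (2 * INR (S m)).
Proof.
  induction m as [|m IH].
  - rewrite H_1. simpl. lra.
  - rewrite H_S. rewrite (S_INR (S m)).
    assert (P : 0 < INR (S m)) by (apply lt_0_INR; lia).
    set (k := INR (S m)) in *.
    assert (0 < 1 / (2 * k) ^ 2) by (apply Rdiv_lt_0_compat; [lra | apply pow_lt; lra]).
    assert (1 / (2 * k) - 1 / (2 * (k + 1)) - 1 / (2 * k) ^ 2
            = (k - 1) / (4 * k ^ 2 * (k + 1))) by (field; lra).
    assert (0 <= (k - 1) / (4 * k ^ 2 * (k + 1))).
    { apply Rmult_le_pos.
      - unfold k. rewrite S_INR. pose proof (pos_INR m). lra.
      - apply Rlt_le, Rinv_0_lt_compat. nra. }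
    lra.
Qed.

Lemma is_lim_seq_eq (u : nat -> R) (l l' : R) :
  is_lim_seq u l -> l = l' -> is_lim_seq u l'.
Proof. now intros L <-. Qed.

(** * The coefficients b_k and a_k: recurrences and decay *)

Definition bcoef (k : nat) : R := 1 / (wallis k * INR k).

Definition acoef (k : nat) : R := H k * bcoef k.

(** The final [+ 0] gives this the shape shared with [acoef_rec], with inhomogeneous term y = 0. *)
Lemma bcoef_rec (k : nat) : (1 <= k)%nat ->
  (2 * INR k + 1) * bcoef (S k) = 2 * INR k * bcoef k + 0.
Proof.
  intros Hk. assert (0 < INR k) by (apply lt_0_INR; lia).
  pose proof (wallis_pos k).
  unfold bcoef. rewrite wallis_S, S_INR. field. repeat split; lra.
Qed.

Lemma bcoef_1 : bcoef 1 = 2.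
Proof. unfold bcoef. rewrite wallis_S, wallis_0. simpl. field. Qed.

Lemma acoef_rec (k : nat) : (1 <= k)%nat ->
  (2 * INR k + 1) * acoef (S k) = 2 * INR k * acoef k + bcoef k / (2 * INR k).
Proof.
  intros Hk. pose proof (bcoef_rec k Hk) as E. unfold acoef.
  destruct k as [|m]; [lia|]. rewrite H_S.
  assert (Pm : 0 < INR (S m)) by (apply lt_0_INR; lia).
  set (k := S m) in *.
  replace ((2 * INR k + 1) * ((H k + 1 / (2 * INR k) ^ 2) * bcoef (S k)))
    with ((H k + 1 / (2 * INR k) ^ 2) * ((2 * INR k + 1) * bcoef (S k))) by ring.
  rewrite E. field. lra.
Qed.

Lemma bcoef_pos (m : nat) : 0 < bcoef (S m).
Proof.
  apply Rdiv_lt_0_compat; [lra|].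
  apply Rmult_lt_0_compat; [apply wallis_pos | apply lt_0_INR; lia].
Qed.

(** With k = m+1, b_k^2 k is nonincreasing, because b_(k+1) = 2k/(2k+1) b_k and (2k)^2 (k+1) <=
    (2k+1)^2 k. Its first value is b_1^2 = 4. This yields decay like 1/sqrt(k). *)
Lemma bcoef_sqr_le (m : nat) : bcoef (S m) ^ 2 * (INR m + 1) <= 4.
Proof.
  induction m as [|m IH].
  - rewrite bcoef_1. simpl. lra.
  - pose proof (bcoef_rec (S m) ltac:(lia)) as E. rewrite !S_INR in *.
    pose proof (pos_INR m). set (t := INR m) in *.
    replace (bcoef (S (S m))) with ((2 * t + 2) / (2 * t + 3) * bcoef (S m)).
    + eapply Rle_trans; [|exact IH].
      replace (((2 * t + 2) / (2 * t + 3) * bcoef (S m)) ^ 2 * (t + 1 + 1)) with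
        (bcoef (S m) ^ 2 * ((2 * t + 2) ^ 2 * (t + 2) / (2 * t + 3) ^ 2)) by (field; lra).
      apply Rmult_le_compat_l; [apply pow2_ge_0|].
      apply <- Rle_div_l; [nra | apply pow_lt; lra].
    + apply Rmult_eq_reg_l with (2 * (t + 1) + 1); [|lra]. rewrite E. field. lra.
Qed.

Lemma bcoef_lim : is_lim_seq (fun m => bcoef (S m)) 0.
Proof.
  apply is_lim_seq_le_le with (fun _ => 0) (fun m => 2 * / sqrt (INR m + 1)).
  - intros m. split; [apply Rlt_le, bcoef_pos|].
    pose proof (pos_INR m). pose proof (bcoef_sqr_le m) as B. pose proof (bcoef_pos m).
    assert (Hs : 0 < sqrt (INR m + 1)) by (apply sqrt_lt_R0; lra).
    assert (Hss : sqrt (INR m + 1) * sqrt (INR m + 1) = INR m + 1) by (apply sqrt_sqrt; lra).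
    rewrite <- Hss in B.
    change (bcoef (S m) <= 2 / sqrt (INR m + 1)). apply -> Rle_div_r; [|lra].
    set (s := sqrt (INR m + 1)) in *.
    assert (0 < bcoef (S m) * s) by (apply Rmult_lt_0_compat; lra).
    nra.
  - apply is_lim_seq_const.
  - replace (Finite 0) with (Rbar_mult 2 0) by (simpl; f_equal; ring).
    apply is_lim_seq_scal_l, lim_inv_sqrt.
Qed.

Lemma acoef_lim : is_lim_seq (fun m => acoef (S m)) 0.
Proof.
  apply is_lim_seq_le_le with (fun _ => 0) (fun m => bcoef (S m)).
  - intros m. pose proof (bcoef_pos m) as B. pose proof (H_bounds m) as [H1 H2].
    assert (0 < 1 / (2 * INR (S m))).
    { apply Rdiv_lt_0_compat; [lra|]. apply Rmult_lt_0_compat; [lra | apply lt_0_INR; lia]. }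
    unfold acoef. split; nra.
  - apply is_lim_seq_const.
  - apply bcoef_lim.
Qed.

(** * Partial sums and the recurrence in t *)

(** The parameter [t] is real so that [t - 2] may be -1, where the denominators 2k - 1 are still
    nonzero. *)
Definition psum (x : nat -> R) (t : R) (N : nat) : R :=
  sum_n (fun i => x (S i) / (2 * INR (S i) + t)) N.

Lemma psum_0 (x : nat -> R) (t : R) : psum x t 0 = x 1%nat / (2 + t).
Proof. unfold psum. rewrite sum_O. simpl. now rewrite Rmult_1_r. Qed.

Lemma psum_S (x : nat -> R) (t : R) (N : nat) :
  psum x t (S N) = psum x t N + x (S (S N)) / (2 * INR (S (S N)) + t).
Proof. unfold psum. now rewrite sum_Sn. Qed.

(* Telescopes [(2k+1) x(k+1) / (2k+t) - (2k-1) x(k) / (2k+t-2)]. *)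
Lemma psum_rec (x y : nat -> R) (t : R) (N : nat) :
  1 <= t ->
  (forall k, (1 <= k)%nat -> (2 * INR k + 1) * x (S k) = 2 * INR k * x k + y k) ->
  t * psum x t N = (t - 1) * psum x (t - 2) N + psum y t N + x 1%nat / t
    - (2 * INR (S N) + 1) * x (S (S N)) / (2 * INR (S N) + t).
Proof.
  intros Ht Hx. induction N as [|N IH].
  - rewrite !psum_0. rewrite (Hx 1%nat) by lia. simpl. field. lra.
  - rewrite !psum_S, !Rmult_plus_distr_l, IH. rewrite (Hx (S (S N))) by lia.
    rewrite (S_INR (S N)). pose proof (pos_INR (S N)).
    field. lra.
Qed.

(** Passage to the limit in [psum_rec]. The assumption concerns the product with [t - 1], so at t =
    1 it reduces to the zero sequence. *)
Lemma psum_lim (x y : nat -> R) (t L Y : R) :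
  1 <= t ->
  (forall k, (1 <= k)%nat -> (2 * INR k + 1) * x (S k) = 2 * INR k * x k + y k) ->
  is_lim_seq (fun m => x (S m)) 0 ->
  is_lim_seq (fun N => (t - 1) * psum x (t - 2) N) L ->
  is_lim_seq (psum y t) Y ->
  is_lim_seq (psum x t) ((L + Y + x 1%nat / t) / t).
Proof.
  intros Ht Hx Lx HL HY.
  set (r := fun N => (2 * INR (S N) + 1) * x (S (S N)) / (2 * INR (S N) + t)).
  (* As t >= 1, the ratio (2k+1)/(2k+t) is at most 1, so the boundary term is dominated by
     |x(k+1)|. *)
  assert (Hr : is_lim_seq r 0).
  { apply is_lim_seq_abs_0.
    apply is_lim_seq_le_le with (fun _ => 0) (fun N => Rabs (x (S (S N)))).
    - intros N. split; [apply Rabs_pos|]. unfold r.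
      pose proof (pos_INR (S N)). unfold Rdiv. rewrite !Rabs_mult.
      rewrite (Rabs_pos_eq (2 * INR (S N) + 1)) by lra.
      rewrite (Rabs_pos_eq (/ _)) by (apply Rlt_le, Rinv_0_lt_compat; lra).
      apply <- Rle_div_l; [|lra].
      rewrite Rmult_comm. apply Rmult_le_compat_l; [apply Rabs_pos | lra].
    - apply is_lim_seq_const.
    - apply (is_lim_seq_abs_0 (fun N => x (S (S N)))).
      exact (proj1 (is_lim_seq_incr_1 (fun m => x (S m)) 0) Lx). }
  apply is_lim_seq_ext with
    (fun N => / t * ((t - 1) * psum x (t - 2) N + psum y t N + x 1%nat / t - r N)).
  - intros N. unfold r. rewrite <- (psum_rec x y t N Ht Hx). field. lra.
  - replace (Finite ((L + Y + x 1%nat / t) / t))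
      with (Rbar_mult (/ t) (L + Y + x 1%nat / t - 0)) by (simpl; f_equal; field; lra).
    apply is_lim_seq_scal_l.
    apply is_lim_seq_minus'; [|exact Hr].
    apply is_lim_seq_plus'; [|apply is_lim_seq_const].
    now apply is_lim_seq_plus'.
Qed.

Lemma psum_zero (t : R) (N : nat) : psum (fun _ => 0) t N = 0.
Proof.
  induction N as [|N IH]; [rewrite psum_0 | rewrite psum_S, IH]; unfold Rdiv; ring.
Qed.

Lemma psum_bcoef_lim (t L : R) :
  1 <= t -> is_lim_seq (fun N => (t - 1) * psum bcoef (t - 2) N) L ->
  is_lim_seq (psum bcoef t) ((L + 2 / t) / t).
Proof.
  intros Ht HL.
  replace (L + 2 / t) with (L + 0 + bcoef 1 / t) by (rewrite bcoef_1; ring).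
  apply psum_lim with (fun _ => 0); auto using bcoef_rec, bcoef_lim.
  apply is_lim_seq_ext with (fun _ => 0); [|apply is_lim_seq_const].
  intros N. now rewrite psum_zero.
Qed.

(** * The values U(0) and S(0) *)

(** Each term b_k/(2k) = 2/(w_k (2k)^2) is twice a difference of consecutive first moments. *)
Lemma psum_bcoef_0 (N : nat) :
  psum bcoef 0 N = 2 * (nmoment (fun x => x ^ 1) 0 - nmoment (fun x => x ^ 1) (S N)).
Proof.
  induction N as [|N IH].
  - rewrite psum_0, (nmoment_id_rec 0), bcoef_1, wallis_S, wallis_0. simpl. field.
  - rewrite psum_S, IH, (nmoment_id_rec (S N)). unfold bcoef.
    pose proof (wallis_pos (S (S N))). assert (0 < INR (S (S N))) by (apply lt_0_INR; lia).
    field. lra.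
Qed.

Lemma psum_bcoef_0_lim : is_lim_seq (psum bcoef 0) (PI ^ 2 / 4).
Proof.
  apply is_lim_seq_ext with
    (fun N => 2 * (nmoment (fun x => x ^ 1) 0 - nmoment (fun x => x ^ 1) (S N))).
  - intros N. now rewrite psum_bcoef_0.
  - rewrite nmoment_pow_0.
    replace (Finite (PI ^ 2 / 4)) with (Rbar_mult 2 ((PI / 2) ^ 2 / INR 2 - 0))
      by (simpl; f_equal; field).
    apply is_lim_seq_scal_l, is_lim_seq_minus'; [apply is_lim_seq_const|].
    apply nmoment_id_lim.
Qed.

(** Summation by parts: a_k/(2k) = 2 H(k) (M_1(k-1) - M_1(k)), and the increments 1/(2k)^2 of [H]
    meet M_1(k), giving a sixth of a difference of third moments. The product with [H] is the
    boundary term, which tends to 0 since [H] is bounded. *)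
Lemma psum_acoef_0 (N : nat) :
  psum acoef 0 N
  = (nmoment (fun x => x ^ 3) 0 - nmoment (fun x => x ^ 3) (S N)) / 3
    - 2 * nmoment (fun x => x ^ 1) (S N) * H (S (S N)).
Proof.
  induction N as [|N IH].
  - rewrite psum_0, (nmoment_cube_rec 0), H_S. unfold acoef. rewrite H_1. simpl. field.
  - rewrite psum_S, IH, (nmoment_cube_rec (S N)), (nmoment_id_rec (S N)), (H_S (S N)).
    unfold acoef, bcoef.
    pose proof (wallis_pos (S (S N))). assert (0 < INR (S (S N))) by (apply lt_0_INR; lia).
    field. lra.
Qed.

Lemma psum_acoef_0_lim : is_lim_seq (psum acoef 0) (PI ^ 4 / 192).
Proof.
  apply is_lim_seq_ext with (fun N =>
    / 3 * (nmoment (fun x => x ^ 3) 0 - nmoment (fun x => x ^ 3) (S N))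
    - 2 * (nmoment (fun x => x ^ 1) (S N) * H (S (S N)))).
  - intros N. rewrite psum_acoef_0. unfold Rdiv. ring.
  - rewrite nmoment_pow_0.
    replace (PI ^ 4 / 192) with (/ 3 * ((PI / 2) ^ 4 / INR 4 - 0) - 2 * 0)
      by (simpl; field).
    apply is_lim_seq_minus'.
    + apply (is_lim_seq_scal_l _ (/ 3) (Finite _)).
      apply is_lim_seq_minus'; [apply is_lim_seq_const | apply nmoment_cube_lim].
    + apply (is_lim_seq_scal_l _ 2 (Finite _)).
      apply is_lim_seq_le_le with (fun _ => 0) (fun N => nmoment (fun x => x ^ 1) (S N));
        [|apply is_lim_seq_const | apply nmoment_id_lim].
      intros N. pose proof (nmoment_pow_nonneg 1 (S N)) as M.
      pose proof (H_bounds (S N)) as [H1 H2].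
      assert (0 < 1 / (2 * INR (S (S N)))).
      { apply Rdiv_lt_0_compat; [lra|]. apply Rmult_lt_0_compat; [lra | apply lt_0_INR; lia]. }
      split; nra.
Qed.

(** The inhomogeneous term is resolved by partial fractions: t/(2k(2k+t)) = 1/(2k) - 1/(2k+t), which
    produces (U(0) - U(t))/t. The first coefficient a_1 is 0. *)
Lemma psum_acoef_lim (t U L : R) :
  1 <= t -> is_lim_seq (psum bcoef t) U ->
  is_lim_seq (fun N => (t - 1) * psum acoef (t - 2) N) L ->
  is_lim_seq (psum acoef t) ((L + (PI ^ 2 / 4 - U) / t) / t).
Proof.
  intros Ht HU HL.
  replace (L + (PI ^ 2 / 4 - U) / t) with (L + (PI ^ 2 / 4 - U) / t + acoef 1 / t)
    by (unfold acoef; rewrite H_1; field; lra).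
  apply psum_lim with (fun k => bcoef k / (2 * INR k)); auto using acoef_rec, acoef_lim.
  apply is_lim_seq_ext with (fun N => (psum bcoef 0 N - psum bcoef t N) * / t).
  - intros N. induction N as [|N IH].
    + rewrite !psum_0. simpl. field. lra.
    + rewrite !psum_S, <- IH. assert (0 < INR (S (S N))) by (apply lt_0_INR; lia).
      field. lra.
  - apply (is_lim_seq_scal_r _ (/ t) (Finite _)).
    apply is_lim_seq_minus'; [apply psum_bcoef_0_lim | exact HU].
Qed.

(** * Closed forms for even and odd t *)

(** Both limits go through one induction, since the step for [acoef] uses that for [bcoef]. The
    prefactor [wallis m] solves the homogeneous recurrence: for t = 2m+2, (t-1)/t = w_(m+1)/w_m. *)
Lemma psum_even_lim (m : nat) :
  is_lim_seq (psum bcoef (2 * INR m))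
    (wallis m * (PI ^ 2 / 4 + / 2 * rsum 1 m (fun r => 1 / (wallis r * INR r ^ 2)))) /\
  is_lim_seq (psum acoef (2 * INR m))
    (wallis m / 16 * (PI ^ 4 / 12
      + PI ^ 2 * rsum 1 m (fun j => (1 / wallis j - 1) * (1 / INR j ^ 2))
      - 2 * rsum 1 m (fun r => rsum r m (fun j => 1 / INR j ^ 2)
                               * (1 / (wallis r * INR r ^ 2))))).
Proof.
  induction m as [|m [IHb IHa]].
  - rewrite wallis_0, !rsum_empty by lia. rewrite Rmult_0_r. split.
    + replace (1 * (PI ^ 2 / 4 + / 2 * 0)) with (PI ^ 2 / 4) by ring. apply psum_bcoef_0_lim.
    + replace (1 / 16 * (PI ^ 4 / 12 + PI ^ 2 * 0 - 2 * 0)) with (PI ^ 4 / 192) by field.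
      apply psum_acoef_0_lim.
  - set (t := 2 * INR (S m)).
    pose proof (pos_INR m). pose proof (wallis_pos m).
    assert (Ht : 1 <= t) by (unfold t; rewrite S_INR; lra).
    replace (2 * INR m) with (t - 2) in IHa, IHb by (unfold t; rewrite S_INR; ring).
    apply (is_lim_seq_scal_l _ (t - 1)) in IHb. apply (is_lim_seq_scal_l _ (t - 1)) in IHa.
    pose proof (psum_bcoef_lim t _ Ht IHb) as Lb.
    pose proof (psum_acoef_lim t _ _ Ht Lb IHa) as La.
    (* Each inner sum gains 1/(m+1)^2; the single sum split off is the one in the limit for [bcoef],
       so the two sides match algebraically. *)
    rewrite (rsum_shift_weights 1 m (fun r => rsum r m (fun j => 1 / INR j ^ 2))
      (fun r => rsum r (S m) (fun j => 1 / INR j ^ 2)) _ (1 / INR (S m) ^ 2));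
      [|lia | intros; apply rsum_S; lia].
    rewrite rsum_single. rewrite !(rsum_S 1 m) by lia. rewrite wallis_S.
    unfold t in Lb, La |- *. rewrite S_INR in *.
    split.
    + apply (is_lim_seq_eq _ _ _ Lb).
      field. lra.
    + apply (is_lim_seq_eq _ _ _ La).
      field. lra.
Qed.

(** Same scheme with t = 2m+3, where (t-1)/t = (2m+2)/(2m+3) is the ratio of consecutive prefactors
    2/((2m+1) w_m). *)
Lemma psum_odd_lim (m : nat) :
  is_lim_seq (psum bcoef (2 * INR m + 1))
    (2 / ((2 * INR m + 1) * wallis m) * rsum 0 m (fun r => wallis r / (2 * INR r + 1))) /\
  is_lim_seq (psum acoef (2 * INR m + 1))
    (2 / ((2 * INR m + 1) * wallis m) * rsum 0 m (fun r =>
      (PI ^ 2 / 8 - rsum r m (fun j => 1 / (2 * INR j + 1) ^ 2))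
      * (wallis r / (2 * INR r + 1)))).
Proof.
  induction m as [|m [IHb IHa]].
  - rewrite !rsum_single, wallis_0. simpl (INR 0).
    replace (2 * 0 + 1) with 1 by ring.
    (* At t = 1 the factor t - 1 is zero, so the induction starts without any known value: U(1) = 2
       and S(1) = PI^2/4 - 2. *)
    assert (L0 : forall x, is_lim_seq (fun N => (1 - 1) * psum x (1 - 2) N) 0).
    { intros x. apply is_lim_seq_ext with (fun _ => 0); [|apply is_lim_seq_const].
      intros N. ring. }
    pose proof (psum_bcoef_lim 1 0 (Rle_refl 1) (L0 _)) as Lb.
    pose proof (psum_acoef_lim 1 _ 0 (Rle_refl 1) Lb (L0 _)) as La.
    split.
    + apply (is_lim_seq_eq _ _ _ Lb).
      field.
    + apply (is_lim_seq_eq _ _ _ La).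
      field.
  - set (t := 2 * INR (S m) + 1).
    pose proof (pos_INR m). pose proof (wallis_pos m).
    assert (Ht : 1 <= t) by (unfold t; rewrite S_INR; lra).
    replace (2 * INR m + 1) with (t - 2) in IHa, IHb at 1 by (unfold t; rewrite S_INR; ring).
    apply (is_lim_seq_scal_l _ (t - 1)) in IHb. apply (is_lim_seq_scal_l _ (t - 1)) in IHa.
    pose proof (psum_bcoef_lim t _ Ht IHb) as Lb.
    pose proof (psum_acoef_lim t _ _ Ht Lb IHa) as La.
    rewrite (rsum_shift_weights 0 m
      (fun r => PI ^ 2 / 8 - rsum r m (fun j => 1 / (2 * INR j + 1) ^ 2))
      (fun r => PI ^ 2 / 8 - rsum r (S m) (fun j => 1 / (2 * INR j + 1) ^ 2))
      _ (- (1 / (2 * INR (S m) + 1) ^ 2)));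
      [|lia | intros; rewrite rsum_S by lia; ring].
    rewrite rsum_single. rewrite (rsum_S 0 m) by lia. rewrite wallis_S.
    unfold t in Lb, La |- *. rewrite S_INR in *.
    split.
    + apply (is_lim_seq_eq _ _ _ Lb).
      field. lra.
    + apply (is_lim_seq_eq _ _ _ La).
      field. lra.
Qed.

(** * Translation to the stated series *)

Lemma binom_central (k : nat) : binom (2 * k) k = wallis k * 4 ^ k.
Proof.
  unfold wallis. field. apply pow_nonzero. lra.
Qed.

(** [is_series] is convergence of the [sum_n] partial sums, so a termwise identity suffices; the
    powers of 4 cancel. *)
Lemma is_series_term (n : nat) (l : R) :
  is_lim_seq (psum acoef (INR n)) l -> is_series (fun i => term n (S i)) l.
Proof.
  intros L. apply (is_lim_seq_ext (psum acoef (INR n)) _ (Finite l)); [|exact L].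
  intros N. apply sum_n_ext; intros i.
  change (acoef (S i) / (2 * INR (S i) + INR n) = term n (S i)).
  unfold acoef, bcoef, term.
  rewrite binom_central.
  pose proof (wallis_pos (S i)). assert (0 < INR (S i)) by (apply lt_0_INR; lia).
  assert (4 ^ S i <> 0) by (apply pow_nonzero; lra).
  pose proof (pos_INR n). field. repeat split; lra.
Qed.

Theorem corollary7p3 :
  (forall n : nat, Nat.Even n ->
     is_series (fun i : nat => term n (S i))
       (binom n (n / 2) / 2 ^ (n + 4) *
        (PI ^ 4 / 12
         + PI ^ 2 * rsum 1 (n / 2) (fun j =>
             (4 ^ j / binom (2 * j) j - 1) * (1 / INR j ^ 2))
         - 2 * rsum 1 (n / 2) (fun r =>
             rsum r (n / 2) (fun j => 1 / INR j ^ 2)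
             * (4 ^ r / (binom (2 * r) r * INR r ^ 2))))))
  /\
  (forall n : nat, Nat.Odd n ->
     is_series (fun i : nat => term n (S i))
       (2 ^ n / (INR n * binom (n - 1) ((n - 1) / 2)) *
        rsum 0 ((n - 1) / 2) (fun r =>
          (PI ^ 2 / 8
           - rsum r ((n - 1) / 2) (fun j => 1 / (2 * INR j + 1) ^ 2))
          * (binom (2 * r) r / ((2 * INR r + 1) * 4 ^ r))))).
Proof.
  split.
  - intros n [m ->]. rewrite (Nat.mul_comm 2 m), Nat.div_mul, (Nat.mul_comm m 2) by lia.
    apply is_series_term. rewrite mult_INR. change (INR 2) with 2.
    destruct (psum_even_lim m) as [_ L].
    (* Here 2^(2m+4) = 16 · 4^m. *)
    replace (binom (2 * m) m / 2 ^ (2 * m + 4)) with (wallis m / 16).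
    + rewrite (rsum_ext _ _ (fun j => (4 ^ j / binom (2 * j) j - 1) * (1 / INR j ^ 2))
        (fun j => (1 / wallis j - 1) * (1 / INR j ^ 2)));
        [rewrite (rsum_ext _ _ (fun r => rsum r m (fun j => 1 / INR j ^ 2)
             * (4 ^ r / (binom (2 * r) r * INR r ^ 2)))
          (fun r => rsum r m (fun j => 1 / INR j ^ 2) * (1 / (wallis r * INR r ^ 2))));
          [exact L|]|];
        intros k Hk; rewrite binom_central; pose proof (wallis_pos k);
        assert (4 ^ k <> 0) by (apply pow_nonzero; lra);
        assert (0 < INR k) by (apply lt_0_INR; lia);
        field; repeat split; lra.
    + rewrite binom_central, pow_add, pow_mult. replace (2 ^ 2) with 4 by ring.
      field. apply pow_nonzero. lra.
  - intros n [m ->]. replace (2 * m + 1 - 1)%nat with (m * 2)%nat by lia.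
    rewrite Nat.div_mul, (Nat.mul_comm m 2) by lia.
    apply is_series_term. rewrite plus_INR, mult_INR. change (INR 2) with 2. change (INR 1) with 1.
    destruct (psum_odd_lim m) as [_ L].
    (* Here 2^(2m+1) = 2 · 4^m, and 4^m is absorbed into [wallis m]. *)
    replace (2 ^ (2 * m + 1) / ((2 * INR m + 1) * binom (2 * m) m))
      with (2 / ((2 * INR m + 1) * wallis m)).
    + erewrite (rsum_ext 0 m); [exact L|]. intros k Hk. cbv beta.
      rewrite binom_central. pose proof (pos_INR k). f_equal.
      field. split; [lra | apply pow_nonzero; lra].
    + rewrite binom_central, pow_add, pow_mult. replace (2 ^ 2) with 4 by ring.
      pose proof (wallis_pos m). pose proof (pos_INR m).
      assert (4 ^ m <> 0) by (apply pow_nonzero; lra).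
      field. repeat split; lra.
Qed.
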